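(* Let $G$ be a group and $R$ a unital $G$-graded $*$-ring. The following are equivalent: (i) The ring $R$ is strongly graded, i.e. $R_gR_h=R_{gh}$ for all $g,h\in G$. (ii) The form functors $((-)_1,\varphi)$, from $G$-graded right $R$-modules to right $R_1$-modules, and $(-\otimes_{R_1}R,\psi)$, from right $R_1$-modules to $G$-graded right $R$-modules, are mutual inverse equivalences of categories with duality. Here $(-)_1$ is $M\mapsto M_1$ (the homogeneous component of degree $1\in G$), and the form functor structures are $$\varphi_M:(M^* )_1\to(M_1)^*,\quad \varphi_M(f)=f|_{M_1}^{R_1};\qquad \psi_N:N^*\otimes_{R_1}R\to(N\otimes_{R_1}R)^*,\quad \psi_N(f\otimes r)(n\otimes s)=s^*f(n)r,$$ where $f|_{M_1}^{R_1}$ denotes $f$ restricted to $M_1$ and corestricted to $R_1$.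
   Context: A $G$-graded $*$-ring is a $G$-graded ring $R=\bigoplus_{g\in G}R_g$ with an involution such that $R_g^*\subset R_{g^{-1}}$ for all $g\in G$. Modules are unital right modules; morphisms of graded modules preserve degree. $N\otimes_{R_1}R$ is graded by $(N\otimes_{R_1}R)_g=N\otimes_{R_1}R_g$. Duality. The hermitian dual of a $G$-graded right $R$-module $M$ is the right module $M^*=\{f\in\mathrm{Hom}_{\mathbb{Z}}(M,R): f(xa)=a^*f(x)\ \forall a\in R,\ x\in M\}$, with $(fa)(x)=f(x)a$. For $d\in G$ put $M^*_d=(M^* )_d=\{f\in M^*: f(M_g)\subset R_{g^{-1}d}\ \forall g\in G\}$. The sum $\sum_{d\in G}M^*_d$ is always direct, but the inclusion $\bigoplus_{d\in G}M^*_d\subset M^*$ may be strict; it is an equality, so that $M^*$ is $G$-graded, when $M$ is finitely presented. The dual of an $R_1$-module $N$ is defined in the same way: $N^*=\{f\in\mathrm{Hom}_{\mathbb{Z}}(N,R_1): f(xa)=a^*f(x)\ \forall a\in R_1,\ x\in N\}$. The category of $G$-graded right $R$-modules and the category of right $R_1$-modules are regarded as categories with duality by means of $*$ and the natural transformation $\mathrm{can}_M:M\to M^{**}$, $\mathrm{can}_M(x)(f)=f(x)^*$. A category with duality $(\mathcal{C},*,\eta)$ consists of a category $\mathcal{C}$, a functor $*:\mathcal{C}^{\mathrm{op}}\to\mathcal{C}$ and a natural transformation $\eta:1\Rightarrow **$ with $(\eta_A)^*\circ\eta_{A^*}=1_{A^*}$. A form functor $(F,\varphi):(\mathcal{A},*,\alpha)\to(\mathcal{B},*,\beta)$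 is a functor $F$ with a natural transformation $\varphi:F\circ *\Rightarrow *\circ F$ such that $\varphi_A^*\circ\beta_{FA}=\varphi_{A^*}\circ F(\alpha_A)$. Composition is $(F',\varphi')\circ(F,\varphi)=(F'F,\ \varphi'_{F}\circ F'(\varphi))$. A natural isomorphism of form functors $(F,\varphi)\Rightarrow(F',\varphi')$ is a natural isomorphism $\theta:F\Rightarrow F'$ with $\varphi_A=\theta_A^*\circ\varphi'_A\circ\theta_{A^*}$. Mutual inverse equivalences of categories with duality are form functors whose two composites are naturally isomorphic, as form functors, to the identity form functors.
   Formalization: Since M^* need not be graded for an arbitrary graded module M, the duality on G-graded right R-modules is taken to be the graded part of M^*, namely the direct sum of the M^*_d, which equals M^* whenever M^* is graded. *)

(* Defs.v *)
From HB Require Import structures.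
From mathcomp Require Import all_boot all_order all_algebra generic_quotient.
From mathcomp Require Import all_classical.

Set Implicit Arguments.
Unset Strict Implicit.
Unset Printing Implicit Defensive.

Import GRing.Theory.
Local Open Scope ring_scope.
Local Open Scope quotient_scope.

Record category := Category {
  ob :> Type;
  hom : ob -> ob -> Type;
  idm : forall A, hom A A;
  cmp : forall A B C, hom B C -> hom A B -> hom A C;
  cmp1m : forall A B (f : hom A B), cmp (idm B) f = f;
  cmpm1 : forall A B (f : hom A B), cmp f (idm A) = f;
  cmpA : forall A B C D (h : hom C D) (g : hom B C) (f : hom A B),
    cmp h (cmp g f) = cmp (cmp h g) f }.

Arguments hom {_} _ _.
Arguments idm {_} A.
Notation "f '\oc' g" := (cmp f g) (at level 50, left associativity).

Definition is_iso (C : category) (A B : C) (f : hom A B) : Prop :=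
  exists2 g : hom B A, g \oc f = idm A & f \oc g = idm B.

Definition opcat (C : category) : category :=
  @Category C (fun A B => hom B A) (@idm C) (fun A B D f g => g \oc f)
    (fun A B f => cmpm1 f) (fun A B f => cmp1m f)
    (fun A B D E h g f => esym (cmpA f g h)).

Record functor (C D : category) := Functor {
  fob :> C -> D;
  fmap : forall A B, hom A B -> hom (fob A) (fob B);
  fmap1 : forall A, fmap (idm A) = idm (fob A);
  fmapM : forall A B E (g : hom B E) (f : hom A B),
    fmap (g \oc f) = fmap g \oc fmap f }.

Arguments fmap {_ _} _ {_ _} _.

Definition idfunctor (C : category) : functor C C :=
  @Functor C C id (fun _ _ f => f) (fun _ => erefl) (fun _ _ _ _ _ => erefl).

Program Definition compfunctor (C D E : category) (G : functor D E)
    (F : functor C D) : functor C E :=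
  @Functor C E (fun A => G (F A)) (fun _ _ f => fmap G (fmap F f)) _ _.
Next Obligation. by move=> * /=; rewrite !fmap1. Qed.
Next Obligation. by move=> * /=; rewrite !fmapM. Qed.

Definition comap (C : category) (D : functor (opcat C) C) (A B : C)
  (f : hom A B) : hom (D B) (D A) := @fmap _ _ D B A f.

Record dualcat := DualCat {
  dcat :> category;
  dual : functor (opcat dcat) dcat;
  eta : forall A : dcat, @hom dcat A (dual (dual A));
  eta_natural : forall (A B : dcat) (f : @hom dcat A B),
    eta B \oc f = comap dual (comap dual f) \oc eta A;
  eta_dual : forall A : dcat,
    comap dual (eta A) \oc eta (dual A) = idm (dual A) }.

Arguments eta : clear implicits.

Definition dualm (C : dualcat) (A B : C) (f : @hom C A B) :
  @hom C (dual C B) (dual C A) := comap (dual C) f.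

Record formfunctor (A B : dualcat) := FormFunctor {
  ffun :> functor A B;
  fform : forall X : A, @hom B (ffun (dual A X)) (dual B (ffun X));
  fform_natural : forall (X Y : A) (f : @hom A X Y),
    fform X \oc fmap ffun (dualm f) = dualm (fmap ffun f) \oc fform Y;
  fform_eta : forall X : A,
    dualm (fform X) \oc eta B (ffun X)
      = fform (dual A X) \oc fmap ffun (eta A X) }.

Arguments fform {_ _} _ X.

Lemma dualmM (C : dualcat) (A B D : C) (g : @hom C B D) (f : @hom C A B) :
  dualm (g \oc f) = dualm f \oc dualm g.
Proof. exact: (@fmapM _ _ (dual C) D B A f g). Qed.

Lemma dualm1 (C : dualcat) (A : C) : dualm (idm A) = idm (dual C A).
Proof. exact: (@fmap1 _ _ (dual C) A). Qed.

Program Definition idform (A : dualcat) : formfunctor A A :=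
  @FormFunctor A A (idfunctor A) (fun X => idm (dual A X)) _ _.
Next Obligation. by move=> * /=; rewrite cmp1m cmpm1. Qed.
Next Obligation. by move=> * /=; rewrite dualm1 !cmp1m. Qed.

Program Definition compform (A B C : dualcat) (G : formfunctor B C)
    (F : formfunctor A B) : formfunctor A C :=
  @FormFunctor A C (compfunctor G F)
    (fun X => fform G (F X) \oc fmap G (fform F X)) _ _.
Next Obligation.
move=> A B C G F X Y f /=; rewrite -cmpA -fmapM fform_natural fmapM cmpA.
by rewrite (fform_natural G) -cmpA.
Qed.
Next Obligation.
move=> A B C G F X /=; rewrite dualmM -cmpA (fform_eta G) cmpA -(fform_natural G) -!cmpA -!fmapM.
by rewrite (fform_eta F).
Qed.

Definition form_isomorphic (A B : dualcat) (F F' : formfunctor A B) : Prop :=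
  exists theta : forall X : A, @hom B (F X) (F' X),
    [/\ forall (X Y : A) (f : @hom A X Y),
          theta Y \oc fmap F f = fmap F' f \oc theta X,
        forall X, is_iso (theta X)
      & forall X, fform F X
          = dualm (theta X) \oc fform F' X \oc theta (dual A X)].

Definition mutual_inverse_equivalences (A B : dualcat)
    (F : formfunctor A B) (G : formfunctor B A) : Prop :=
  form_isomorphic (compform G F) (idform A) /\
  form_isomorphic (compform F G) (idform B).

HB.mixin Record PzRing_hasInvolution R of GRing.PzRing R := {
  star : R -> R;
  starD : {morph star : x y / x + y};
  starM : forall x y, star (x * y) = star y * star x;
  starK : involutive star }.

#[short(type="starRingType")]
HB.structure Definition StarRing :=
  {R of PzRing_hasInvolution R & GRing.PzRing R}.

(* A right S-module is a left module over the converse ring S^c.            *)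
Notation "x <* a" := (@GRing.scale (GRing.converse _) _ a x)
  (at level 40, left associativity) : ring_scope.

Section StarTheory.
Variable S : starRingType.

Lemma star0 : star 0 = 0 :> S.
Proof. by apply: (@addrI _ (star 0)); rewrite -starD !addr0. Qed.
Lemma starN : {morph @star S : x / - x}.
Proof.
by move=> x; apply: (@addrI _ (star x)); rewrite -starD !subrr star0.
Qed.
Lemma star1 : star 1 = 1 :> S.
Proof. by rewrite -[LHS]mul1r -{1}[1 : S]starK -starM mul1r starK. Qed.
Lemma star_sum I r (P : pred I) (F : I -> S) :
  star (\sum_(i <- r | P i) F i) = \sum_(i <- r | P i) star (F i).
Proof. by apply: (big_morph _ starD star0). Qed.

Lemma ractA (M : lmodType S^c) (x : M) (a b : S) : x <* a <* b = x <* (a * b).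
Proof. by rewrite scalerA. Qed.
Lemma ract1 (M : lmodType S^c) (x : M) : x <* (1 : S) = x.
Proof. exact: (scale1r (x : M)). Qed.
Lemma ractDl (M : lmodType S^c) (x y : M) (a : S) :
  (x + y) <* a = x <* a + y <* a.
Proof. exact: scalerDr. Qed.
Lemma ractDr (M : lmodType S^c) (x : M) (a b : S) :
  x <* (a + b) = x <* a + x <* b.
Proof. exact: (scalerDl (R := S^c)). Qed.
End StarTheory.

Lemma linear_ext (K : pzRingType) (U V : lmodType K) (f g : {linear U -> V}) :
  f =1 g -> f = g.
Proof.
case: f => f [[f1] [f2]]; case: g => g [[g1] [g2]] /= /funext fg.
move: fg f1 f2 g1 g2; rewrite /GRing.Linear.sort /= => -> f1 f2 g1 g2.
by rewrite (Prop_irrelevance f1 g1) (Prop_irrelevance f2 g2).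
Qed.

Definition hermitian (S : starRingType) (M : lmodType S^c) (f : M -> S) :=
  {morph f : x y / x + y} /\ (forall (a : S) x, f (x <* a) = star a * f x).

Section HermitianDual.
Variables (S : starRingType) (M : lmodType S^c).

Definition hermitian_pred : {pred M -> S} := [pred f | `[< hermitian f >]].

Fact hermitian_zmod_closed : zmod_closed hermitian_pred.
Proof.
split=> [|f g /asboolP[fD fZ] /asboolP[gD gZ]]; apply/asboolP; split.
- by move=> x y /=; rewrite addr0.
- by move=> a x /=; rewrite mulr0.
- by move=> x y /=; rewrite !fctE fD gD opprD addrACA.
- by move=> a x /=; rewrite !fctE fZ gZ mulrBr.
Qed.

HB.instance Definition _ :=
  GRing.isZmodClosed.Build (M -> S) hermitian_pred hermitian_zmod_closed.

Record hdual := HDual { hdual_fun :> M -> S; _ : hdual_fun \in hermitian_pred }.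

HB.instance Definition _ := [isSub for hdual_fun].
HB.instance Definition _ := [Choice of hdual by <:].
HB.instance Definition _ := [SubChoice_isSubZmodule of hdual by <:].

Definition Hdual f (hf : hermitian f) : hdual := HDual (asboolT hf).

Lemma hdualD (f : hdual) x y : f (x + y) = f x + f y.
Proof. by case: f => f /= /asboolP[]. Qed.
Lemma hdualZ (f : hdual) x (a : S) : f (x <* a) = star a * f x.
Proof. by case: f => f /= /asboolP[]. Qed.
Lemma hdual0 (f : hdual) : f 0 = 0.
Proof. by apply: (@addrI _ (f 0)); rewrite -hdualD !addr0. Qed.
Lemma hdualN (f : hdual) x : f (- x) = - f x.
Proof. by apply: (@addrI _ (f x)); rewrite -hdualD !subrr hdual0. Qed.
Lemma hdual_sum (f : hdual) I r (P : pred I) (F : I -> M) :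
  f (\sum_(i <- r | P i) F i) = \sum_(i <- r | P i) f (F i).
Proof. by apply: (big_morph f (hdualD f) (hdual0 f)). Qed.

Lemma hdual_ext (f g : hdual) : f =1 g -> f = g.
Proof. by move=> fg; apply/val_inj/funext. Qed.

Lemma hdual_addE (f g : hdual) x : (f + g) x = f x + g x.
Proof. by []. Qed.
Lemma hdual_zeroE x : (0 : hdual) x = 0.
Proof. by []. Qed.
Lemma hdual_oppE (f : hdual) x : (- f) x = - f x.
Proof. by []. Qed.
Lemma hdual_sumE I r (P : pred I) (F : I -> hdual) x :
  (\sum_(i <- r | P i) F i) x = \sum_(i <- r | P i) F i x.
Proof.
by apply: (big_morph (fun f : hdual => f x)) => // f g; rewrite hdual_addE.
Qed.

Fact hdual_act_subproof (a : S^c) (f : hdual) :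
  hermitian (fun x => f x * (a : S)).
Proof.
by split=> [x y | b x] /=; rewrite ?hdualD ?mulrDl // hdualZ mulrA.
Qed.

Definition hdual_act (a : S^c) (f : hdual) : hdual :=
  Hdual (hdual_act_subproof a f).

Fact hdual_actA a b v : hdual_act a (hdual_act b v) = hdual_act (a * b) v.
Proof. by apply: hdual_ext => x /=; rewrite -mulrA. Qed.
Fact hdual_act1 : left_id 1 hdual_act.
Proof. by move=> f; apply: hdual_ext => x /=; rewrite mulr1. Qed.
Fact hdual_actDr : right_distributive hdual_act +%R.
Proof. by move=> a f g; apply: hdual_ext => x /=; rewrite mulrDl. Qed.
Fact hdual_actDl v : {morph hdual_act^~ v : a b / a + b}.
Proof. by move=> a b; apply: hdual_ext => x /=; rewrite mulrDr. Qed.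

HB.instance Definition _ := GRing.Zmodule_isLmodule.Build S^c hdual
  hdual_actA hdual_act1 hdual_actDr hdual_actDl.

Lemma hdual_actE (f : hdual) (a : S) x : (f <* a) x = f x * a.
Proof. by []. Qed.

End HermitianDual.

Section HdualMap.
Variables (S : starRingType) (M N : lmodType S^c) (u : {linear M -> N}).

Fact hdual_map_subproof (f : hdual N) : hermitian (f \o u).
Proof. by split=> [x y|a x] /=; rewrite ?linearD ?hdualD // linearZ hdualZ. Qed.

Definition hdual_map (f : hdual N) : hdual M := Hdual (hdual_map_subproof f).

Fact hdual_map_linear : linear hdual_map.
Proof. by move=> a f g; apply: hdual_ext => x. Qed.

HB.instance Definition _ :=
  GRing.isLinear.Build S^c (hdual N) (hdual M) _ hdual_map hdual_map_linear.

End HdualMap.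

Section HdualCan.
Variables (S : starRingType) (M : lmodType S^c).

Fact hdual_can_subproof (x : M) : hermitian (fun f : hdual M => star (f x)).
Proof. by split=> [f g | a f]; [exact: starD | exact: starM]. Qed.

Definition hdual_can (x : M) : hdual (hdual M) := Hdual (hdual_can_subproof x).

Fact hdual_can_linear : linear hdual_can.
Proof.
move=> a x y; apply: hdual_ext => f /=.
by rewrite hdualD hdualZ starD starM starK.
Qed.

HB.instance Definition _ :=
  GRing.isLinear.Build S^c M (hdual (hdual M)) _ hdual_can hdual_can_linear.

End HdualCan.

Section ModuleCategory.
Variable S : starRingType.

Definition modcat : category.
Proof.
refine (@Category (lmodType S^c) (fun M N => {linear M -> N})
  (fun M => idfun) (fun M N P g f => g \o f) _ _ _);
by move=> *; apply: linear_ext.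
Defined.

Definition moddual : functor (opcat modcat) modcat.
Proof.
refine (@Functor (opcat modcat) modcat (fun M : lmodType S^c => hdual M)
  (fun (M N : lmodType S^c) (u : {linear N -> M}) => hdual_map u) _ _);
by move=> *; apply: linear_ext => f; apply: hdual_ext.
Defined.

Definition moddualcat : dualcat.
Proof.
refine (@DualCat modcat moddual (fun M : lmodType S^c => @hdual_can S M) _ _).
- by move=> M N u; apply: linear_ext => x; apply: hdual_ext.
- move=> M; apply: linear_ext => f; apply: hdual_ext => x /=.
  exact: starK.
Defined.

End ModuleCategory.

(* The additive group M is the internal direct sum of the subgroups c g.    *)
Record grading (G : groupType) (M : zmodType) (c : G -> {pred M}) : Prop :=
  Grading {
    grading_closed : forall g, zmod_closed (c g);
    grading_span : forall x, exists (s : seq G) (y : G -> M),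
      (forall g, y g \in c g) /\ x = \sum_(g <- s) y g;
    grading_indep : forall (s : seq G) (y : G -> M), uniq s ->
      (forall g, y g \in c g) -> \sum_(g <- s) y g = 0 ->
      {in s, forall g, y g = 0} }.

HB.mixin Record StarRing_isGraded (G : groupType) R of StarRing R := {
  rcomp : G -> {pred R};
  rcomp_grading : grading rcomp;
  rcompM : forall g h, {in rcomp g & rcomp h, forall a b,
    a * b \in rcomp (g * h)%g};
  rcomp_star : forall g, {in rcomp g, forall a, star a \in rcomp g^-1%g} }.

#[short(type="grStarRingType")]
HB.structure Definition GrStarRing (G : groupType) :=
  {R of StarRing R & StarRing_isGraded G R}.

HB.mixin Record Lmodule_isGraded (G : groupType) (R : grStarRingType G) M
    of GRing.Lmodule R^c M := {
  mcomp : G -> {pred M};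
  mcomp_grading : grading mcomp;
  mcomp_act : forall g h (x : M) (a : R), x \in mcomp g -> a \in rcomp h ->
    x <* a \in mcomp (g * h)%g }.

#[short(type="grmodType")]
HB.structure Definition GrModule (G : groupType) (R : grStarRingType G) :=
  {M of GRing.Lmodule R^c M & Lmodule_isGraded G R M}.

Section GradingTheory.
Variables (G : groupType) (M : zmodType) (c : G -> {pred M}).
Hypothesis gr : grading c.

Lemma grading0 g : 0 \in c g.
Proof. by case: (grading_closed gr g). Qed.
Lemma gradingB g x y : x \in c g -> y \in c g -> x - y \in c g.
Proof. by case: (grading_closed gr g) => _; apply. Qed.
Lemma gradingN g x : x \in c g -> - x \in c g.
Proof. by rewrite -sub0r => xg; apply: gradingB => //; apply: grading0. Qed.
Lemma gradingD g x y : x \in c g -> y \in c g -> x + y \in c g.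
Proof. by move=> xg yg; rewrite -[y]opprK; apply: gradingB => //; apply: gradingN. Qed.
Lemma grading_sum g I r (P : pred I) (F : I -> M) :
  (forall i, P i -> F i \in c g) -> \sum_(i <- r | P i) F i \in c g.
Proof.
by move=> FP; apply: (big_ind [in c g]); [apply: grading0 | move=> ? ?; apply: gradingD | apply: FP].
Qed.

Lemma grading_uniq_span x : exists (s : seq G) (y : G -> M),
  [/\ uniq s, forall g, y g \in c g, forall g, g \notin s -> y g = 0
    & x = \sum_(g <- s) y g].
Proof.
have [s [y [yc ->]]] := grading_span gr x.
exists (undup s), (fun g => if g \in s then y g *+ count_mem g s else 0).
split; first exact: undup_uniq.
- move=> g; case: ifP => _; last exact: grading0.
  elim: (count_mem g s) => [|n IH]; first exact: grading0.
  by rewrite mulrS; apply: gradingD.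
- by move=> g; rewrite mem_undup => /negbTE->.
- transitivity (\sum_(g <- undup s) y g *+ count_mem g s); last first.
    by apply: eq_big_seq => g; rewrite mem_undup => ->.
  by rewrite -big_undup_iterop_count; apply: eq_bigr => g _.
Qed.

Lemma big_support_subset (s u : seq G) (y : G -> M) :
  uniq s -> uniq u -> {subset s <= u} -> (forall g, g \notin s -> y g = 0) ->
  \sum_(g <- s) y g = \sum_(g <- u) y g.
Proof.
move=> us uu su y0; rewrite [RHS](bigID [in s]) /= [X in _ + X]big1 => [|g /y0//].
rewrite addr0 -[RHS]big_filter; apply: perm_big; apply: uniq_perm => //.
  exact: filter_uniq.
by move=> g; rewrite mem_filter; case: (boolP (g \in s)) => // /su ->.
Qed.

Lemma big_count_subset (u v : seq G) (y : G -> M) :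
  uniq v -> {subset u <= v} ->
  \sum_(g <- u) y g = \sum_(g <- v) y g *+ count_mem g u.
Proof.
move=> uv us; rewrite -big_undup_iterop_count.
apply: big_support_subset => //; first exact: undup_uniq.
  by move=> g; rewrite mem_undup; apply: us.
by move=> g; rewrite mem_undup => /count_memPn ->.
Qed.

Lemma grading_inj (s t : seq G) (y z : G -> M) : uniq s -> uniq t ->
  (forall g, y g \in c g) -> (forall g, z g \in c g) ->
  (forall g, g \notin s -> y g = 0) -> (forall g, g \notin t -> z g = 0) ->
  \sum_(g <- s) y g = \sum_(g <- t) z g -> y =1 z.
Proof.
move=> us ut yc zc y0 z0; set u := undup (s ++ t); have uu : uniq u by exact: undup_uniq.
rewrite (big_support_subset us uu) => [|g gs|//]; last by rewrite mem_undup mem_cat gs.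
rewrite (big_support_subset ut uu) => [|g gs|//]; last by rewrite mem_undup mem_cat gs orbT.
move/eqP; rewrite -subr_eq0 -sumrB => /eqP yz0 g.
have [gu|] := boolP (g \in u).
  apply/eqP; rewrite -subr_eq0; apply/eqP.
  by apply: (grading_indep gr uu _ yz0 gu) => h; apply: gradingB.
by rewrite mem_undup mem_cat negb_or => /andP[/y0-> /z0->].
Qed.

Fact hproj_key x : exists y : G -> M, exists2 s : seq G, uniq s &
  [/\ forall g, y g \in c g, forall g, g \notin s -> y g = 0
    & x = \sum_(g <- s) y g].
Proof. by have [s [y [? ? ? ?]]] := grading_uniq_span x; exists y, s. Qed.

Definition hproj (x : M) (g : G) : M := projT1 (cid (hproj_key x)) g.

Lemma hprojP x : exists2 s : seq G, uniq s &
  [/\ forall g, hproj x g \in c g, forall g, g \notin s -> hproj x g = 0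
    & x = \sum_(g <- s) hproj x g].
Proof. exact: (projT2 (cid (hproj_key x))). Qed.

Lemma hproj_in x g : hproj x g \in c g.
Proof. by have [s _ []] := hprojP x. Qed.

Lemma hproj_uniq (s : seq G) (y : G -> M) x : uniq s ->
  (forall g, y g \in c g) -> (forall g, g \notin s -> y g = 0) ->
  x = \sum_(g <- s) y g -> hproj x =1 y.
Proof.
move=> us yc y0 xE; have [t ut [zc z0]] := hprojP x.
by rewrite {1}xE => /esym/grading_inj; apply.
Qed.

Lemma hprojB x y g : hproj (x - y) g = hproj x g - hproj y g.
Proof.
have [s us [xc x0 xE]] := hprojP x; have [t ut [yc y0 yE]] := hprojP y.
set u := undup (s ++ t); have uu : uniq u by exact: undup_uniq.
apply: (@hproj_uniq u (fun g => hproj x g - hproj y g)) => //.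
- by move=> h; apply: gradingB.
- by move=> h; rewrite mem_undup mem_cat negb_or => /andP[/x0-> /y0->]; rewrite subr0.
rewrite {1}xE {1}yE sumrB; congr (_ - _); apply: big_support_subset => // h hs;
  by rewrite mem_undup mem_cat hs ?orbT.
Qed.

Lemma hproj_id x g : x \in c g -> hproj x g = x.
Proof.
move=> xg; rewrite (@hproj_uniq [:: g] (fun h => if h == g then x else 0)) ?eqxx //.
- by move=> h; case: eqP => [->|_] //; apply: grading0.
- by move=> h; rewrite inE => /negbTE->.
- by rewrite big_seq1 eqxx.
Qed.

Lemma hproj_neq x g h : x \in c g -> h != g -> hproj x h = 0.
Proof.
move=> xg hg; rewrite (@hproj_uniq [:: g] (fun h => if h == g then x else 0)) ?(negbTE hg) //.
- by move=> k; case: eqP => [->|_] //; apply: grading0.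
- by move=> k; rewrite inE => /negbTE->.
- by rewrite big_seq1 eqxx.
Qed.

End GradingTheory.

Arguments hproj {G M c} gr x g.

Lemma grading_of_proj (G : groupType) (M : zmodType) (c : G -> {pred M})
    (p : G -> M -> M) :
  (forall g, zmod_closed (c g)) ->
  (forall x, exists (s : seq G) (y : G -> M),
     (forall g, y g \in c g) /\ x = \sum_(g <- s) y g) ->
  (forall g, {morph p g : x y / x + y}) ->
  (forall g, {in c g, forall x, p g x = x}) ->
  (forall g h, h != g -> {in c h, forall x, p g x = 0}) -> grading c.
Proof.
move=> cc cs pD pid p0; split=> // s y us yc sy0 g gs.
have pg0 : p g 0 = 0 by apply: (@addrI _ (p g 0)); rewrite -pD !addr0.
move: (congr1 (p g) sy0); rewrite pg0 (big_morph _ (pD g) pg0) (bigD1_seq g) //=.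
rewrite big1 => [|h hg]; last exact: p0 (yc h).
by rewrite addr0 pid.
Qed.

Section GradedRingTheory.
Variables (G : groupType) (R : grStarRingType G).

Lemma rcomp1 : 1 \in rcomp (s := R) 1%g.
Proof.
have gr := @rcomp_grading G R; set e := hproj gr 1 1%g.
have eE (r : R) : e * r = r.
  have [t _ [rc _ ->]] := hprojP gr r; rewrite mulr_sumr; apply: eq_bigr => g _.
  move: (hproj gr r g) (rc g) => {rc t}r rg.
  have [s us [oc o0 oE]] := hprojP gr (1 : R).
  have rE : r = \sum_(h <- [seq (h * g)%g | h <- s]) hproj gr 1 (h * g^-1)%g * r.
    rewrite big_map -[LHS]mul1r {1}oE mulr_suml.
    by apply: eq_bigr => h _; rewrite mulgK.
  rewrite -[RHS](hproj_id gr rg).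
  rewrite (hproj_uniq gr _ _ _ rE) ?mulgV //.
  - by rewrite map_inj_uniq //; apply: mulIg.
  - by move=> h; rewrite -{2}[h](mulgVK g); apply: rcompM.
  - move=> h hs; rewrite o0 ?mul0r //; apply: contra hs => hs.
    by apply/mapP; exists (h * g^-1)%g => //; rewrite mulgVK.
by rewrite -[1]eE mulr1; apply: hproj_in.
Qed.

End GradedRingTheory.

Section DegreeOneRing.
Variables (G : groupType) (R : grStarRingType G).

Definition deg1_pred : {pred R} := rcomp (s := R) 1%g.

Fact deg1_subring_closed : subring_closed deg1_pred.
Proof.
have gr := @rcomp_grading G R; split; first exact: rcomp1.
  by move=> x y; apply: (gradingB gr).
by move=> x y xi yi; rewrite /deg1_pred -(mulg1 1%g); apply: rcompM.
Qed.

HB.instance Definition _ :=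
  GRing.isSubringClosed.Build R deg1_pred deg1_subring_closed.

Record deg1ring := Deg1Ring { deg1val :> R; _ : deg1val \in deg1_pred }.

HB.instance Definition _ := [isSub for deg1val].
HB.instance Definition _ := [Choice of deg1ring by <:].
HB.instance Definition _ :=
  GRing.SubChoice_isSubPzRing.Build R deg1_pred deg1ring deg1_subring_closed.

Lemma deg1ring_ext (a b : deg1ring) : deg1val a = deg1val b -> a = b.
Proof. exact: val_inj. Qed.
Lemma deg1valD (a b : deg1ring) : deg1val (a + b) = deg1val a + deg1val b.
Proof. by []. Qed.
Lemma deg1valM (a b : deg1ring) : deg1val (a * b) = deg1val a * deg1val b.
Proof. by []. Qed.

Fact deg1star_subproof (a : deg1ring) : star (a : R) \in deg1_pred.
Proof. by rewrite /deg1_pred -invg1; apply: rcomp_star (valP a). Qed.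

Definition deg1star (a : deg1ring) : deg1ring := Deg1Ring (deg1star_subproof a).

Fact deg1starD : {morph deg1star : x y / x + y}.
Proof. by move=> a b; apply/val_inj/starD. Qed.
Fact deg1starM x y : deg1star (x * y) = deg1star y * deg1star x.
Proof. exact/val_inj/starM. Qed.
Fact deg1starK : involutive deg1star.
Proof. by move=> a; apply/val_inj/starK. Qed.

HB.instance Definition _ :=
  PzRing_hasInvolution.Build deg1ring deg1starD deg1starM deg1starK.

End DegreeOneRing.

Section DegreeOneModule.
Variables (G : groupType) (R : grStarRingType G) (M : grmodType R).

Definition mdeg1_pred : {pred M} := mcomp (s := M) 1%g.

Fact mdeg1_zmod_closed : zmod_closed mdeg1_pred.
Proof. exact: grading_closed (@mcomp_grading G R M) 1%g. Qed.

HB.instance Definition _ :=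
  GRing.isZmodClosed.Build M mdeg1_pred mdeg1_zmod_closed.

Record deg1mod := Deg1Mod { mdeg1val :> M; _ : mdeg1val \in mdeg1_pred }.

HB.instance Definition _ := [isSub for mdeg1val].
HB.instance Definition _ := [Choice of deg1mod by <:].
HB.instance Definition _ := [SubChoice_isSubZmodule of deg1mod by <:].

Fact deg1act_subproof (a : deg1ring R) (x : deg1mod) :
  (x : M) <* (a : R) \in mdeg1_pred.
Proof.
by rewrite /mdeg1_pred -(mulg1 1%g); apply: mcomp_act (valP x) (valP a).
Qed.

Definition deg1act (a : (deg1ring R)^c) (x : deg1mod) : deg1mod :=
  Deg1Mod (deg1act_subproof a x).

Fact deg1actA a b v : deg1act a (deg1act b v) = deg1act (a * b) v.
Proof. exact/val_inj/(ractA (val v : M)). Qed.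
Fact deg1act1 : left_id 1 deg1act.
Proof. by move=> v; apply/val_inj/(ract1 (val v : M)). Qed.
Fact deg1actDr : right_distributive deg1act +%R.
Proof. by move=> a x y; apply/val_inj/ractDl. Qed.
Fact deg1actDl v : {morph deg1act^~ v : a b / a + b}.
Proof. by move=> a b; apply/val_inj/(ractDr (val v : M)). Qed.

HB.instance Definition _ := GRing.Zmodule_isLmodule.Build (deg1ring R)^c deg1mod
  deg1actA deg1act1 deg1actDr deg1actDl.

Lemma deg1mod_ext (x y : deg1mod) : mdeg1val x = mdeg1val y -> x = y.
Proof. exact: val_inj. Qed.
Lemma mdeg1valD (x y : deg1mod) : mdeg1val (x + y) = mdeg1val x + mdeg1val y.
Proof. by []. Qed.
Lemma mdeg1valZ (x : deg1mod) (a : deg1ring R) :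
  mdeg1val (x <* a) = mdeg1val x <* deg1val a.
Proof. by []. Qed.

End DegreeOneModule.

Record grhom (G : groupType) (R : grStarRingType G) (M N : grmodType R) :=
  GrHom {
    grhom_fun :> {linear M -> N};
    grhomP : forall g, {in mcomp g, forall x, grhom_fun x \in mcomp g} }.

Section GrHomTheory.
Variables (G : groupType) (R : grStarRingType G).

Lemma grhom_ext (M N : grmodType R) (u v : grhom M N) : u =1 v -> u = v.
Proof.
case: u => u up; case: v => v vp /= uv; have {}uv := linear_ext uv.
by subst v; rewrite (Prop_irrelevance up vp).
Qed.

Definition grid (M : grmodType R) : grhom M M :=
  @GrHom G R M M idfun (fun _ _ xg => xg).

Definition grcomp (M N P : grmodType R) (v : grhom N P) (u : grhom M N) :
    grhom M P :=
  @GrHom G R M P (v \o u) (fun g x xg => grhomP v (grhomP u xg)).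

Definition grcat : category.
Proof.
refine (@Category (grmodType R) (@grhom G R) grid grcomp _ _ _);
by move=> *; apply: grhom_ext.
Defined.

End GrHomTheory.

Section GradedDual.
Variables (G : groupType) (R : grStarRingType G) (M : grmodType R).

Definition dual_comp (d : G) : {pred hdual M} := [pred f : hdual M |
  `[< forall g (x : M), x \in mcomp g -> f x \in rcomp (g^-1 * d)%g >]].

Lemma dual_compP d (f : hdual M) :
  reflect (forall g (x : M), x \in mcomp g -> f x \in rcomp (g^-1 * d)%g)
    (f \in dual_comp d).
Proof. exact: asboolP. Qed.

Let grR := @rcomp_grading G R.
Let grM := @mcomp_grading G R M.

Lemma dual_comp_closed d : zmod_closed (dual_comp d).
Proof.
split; first by apply/dual_compP => g x _; rewrite hdual_zeroE (grading0 grR).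
move=> f f' /dual_compP fd /dual_compP fd'; apply/dual_compP => g x xg.
by rewrite hdual_addE hdual_oppE (gradingB grR) ?fd ?fd'.
Qed.

Lemma dual_compD d : {in dual_comp d &, forall f f', f + f' \in dual_comp d}.
Proof.
move=> f f' fd f'd; have [c0 cB] := dual_comp_closed d.
by rewrite -[f']opprK -[- f']sub0r; apply: (cB) => //; apply: cB.
Qed.

Lemma dual_compMn d n : {in dual_comp d, forall f, f *+ n \in dual_comp d}.
Proof.
move=> f fd; elim: n => [|n IH]; first by case: (dual_comp_closed d).
by rewrite mulrS; apply: dual_compD.
Qed.

Lemma dual_comp_act d h (f : hdual M) (a : R) :
  f \in dual_comp d -> a \in rcomp h -> f <* a \in dual_comp (d * h)%g.
Proof.
move=> /dual_compP fd ah; apply/dual_compP => g x xg.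
by rewrite hdual_actE mulgA rcompM ?fd.
Qed.

Lemma dual_comp_indep (s : seq G) (y : G -> hdual M) : uniq s ->
  (forall d, y d \in dual_comp d) -> \sum_(d <- s) y d = 0 ->
  {in s, forall d, y d = 0}.
Proof.
move=> us yc sy0 d ds; apply: hdual_ext => x; rewrite hdual_zeroE.
have [t [z [zc ->]]] := grading_span grM x.
rewrite hdual_sum big1 // => g _; move: (z g) (zc g) => {zc x t}x xg.
have /(_ [seq (g^-1 * d)%g | d <- s] (fun k => y (g * k)%g x)) := grading_indep grR.
rewrite map_inj_uniq => [/(_ us)|]; last exact: mulgI.
move=> /(_ _ _ (g^-1 * d)%g); rewrite mulVKg; apply.
- move=> k; rewrite -{2}[k](mulKg g); exact: (elimT (dual_compP _ _) (yc _)).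
- by rewrite big_map -[RHS](hdual_zeroE x) -sy0 hdual_sumE;
    apply: eq_bigr => k _; rewrite mulVKg.
- exact: map_f.
Qed.

(* M^* itself need not be graded; its graded part is the (direct) sum of    *)
(* the M^*_d, which is all of M^* when M is finitely generated.             *)
Definition grdual_pred : {pred hdual M} := [pred f : hdual M |
  `[< exists (s : seq G) (y : G -> hdual M),
        (forall d, y d \in dual_comp d) /\ f = \sum_(d <- s) y d >]].

Lemma grdualP (f : hdual M) :
  reflect (exists (s : seq G) (y : G -> hdual M),
     (forall d, y d \in dual_comp d) /\ f = \sum_(d <- s) y d)
    (f \in grdual_pred).
Proof. exact: asboolP. Qed.

Lemma dual_comp_grdual d f : f \in dual_comp d -> f \in grdual_pred.
Proof.
move=> fd; apply/grdualP.
exists [:: d], (fun e => if e == d then f else 0); split.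
  by move=> e; case: eqP => [->|_] //; case: (dual_comp_closed e).
by rewrite big_seq1 eqxx.
Qed.

Fact grdual_addr_closed : addr_closed grdual_pred.
Proof.
split=> [|f f' /grdualP[s [y [yc ->]]] /grdualP[t [z [zc ->]]]].
  by apply: (@dual_comp_grdual 1%g); case: (dual_comp_closed 1%g).
apply/grdualP; exists (undup (s ++ t)).
exists (fun d => y d *+ count_mem d s + z d *+ count_mem d t); split.
  by move=> d; apply: dual_compD; apply: dual_compMn.
rewrite big_split /= -!(@big_count_subset G) ?undup_uniq // => d;
  by rewrite mem_undup mem_cat => ->; rewrite ?orbT.
Qed.

Fact grdual_submod_closed : submod_closed grdual_pred.
Proof.
case: grdual_addr_closed => c0 cD; split=> // a f f' fG f'G; apply: (cD) => // {f'G}.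
case/grdualP: fG => s [y [yc ->]]; rewrite scaler_sumr.
apply: (big_ind [in grdual_pred]); [exact: c0 | exact: cD | move=> d _]; move: (y d) (yc d) => u ud.
have [t [b [bc aE]]] := grading_span grR a; rewrite {}aE.
rewrite (scaler_suml (R := R^c)).
apply: (big_ind [in grdual_pred]); [exact: c0 | exact: cD | move=> h _].
exact: (dual_comp_grdual (dual_comp_act ud (bc h))).
Qed.

HB.instance Definition _ :=
  GRing.isSubmodClosed.Build R^c (hdual M) grdual_pred grdual_submod_closed.

Record grdual := GrDual { grdual_val :> hdual M; _ : grdual_val \in grdual_pred }.

HB.instance Definition _ := [isSub for grdual_val].
HB.instance Definition _ := [Choice of grdual by <:].
HB.instance Definition _ := [SubChoice_isSubLmodule of grdual by <:].

Lemma grdual_ext (f f' : grdual) : hdual_fun f =1 hdual_fun f' -> f = f'.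
Proof. by move=> ff'; apply/val_inj/hdual_ext. Qed.
Lemma grdual_valD (f f' : grdual) : grdual_val (f + f') = grdual_val f + grdual_val f'.
Proof. by []. Qed.
Lemma grdual_valZ (f : grdual) (a : R) : grdual_val (f <* a) = grdual_val f <* a.
Proof. by []. Qed.

Definition grdual_comp (d : G) : {pred grdual} :=
  [pred f : grdual | grdual_val f \in dual_comp d].

Fact grdual_grading : grading grdual_comp.
Proof.
split.
- move=> d; case: (dual_comp_closed d) => c0 cB.
  by split=> // f f'; apply: cB.
- move=> [f fG]; have /grdualP[s [y [yc yE]]] := fG.
  exists s, (fun d => GrDual (dual_comp_grdual (yc d))); split=> //.
  apply: val_inj; rewrite -[val (GrDual fG)]/f yE.
  by rewrite (raddf_sum (val : grdual -> hdual M)).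
- move=> s y us yc sy0 d ds; apply: val_inj.
  apply: (dual_comp_indep us yc _ ds).
  by rewrite -(raddf_sum (val : grdual -> hdual M)) sy0.
Qed.

Fact grdual_comp_act g h (f : grdual) (a : R) :
  f \in grdual_comp g -> a \in rcomp h -> f <* a \in grdual_comp (g * h)%g.
Proof. exact: dual_comp_act. Qed.

HB.instance Definition _ :=
  Lmodule_isGraded.Build G R grdual grdual_grading grdual_comp_act.

End GradedDual.

Section GradedDualMap.
Variables (G : groupType) (R : grStarRingType G) (M N : grmodType R).
Variable u : grhom M N.

Lemma hdual_map_comp d :
  {in @dual_comp G R N d, forall f, hdual_map u f \in @dual_comp G R M d}.
Proof.
move=> f /dual_compP fd; apply/dual_compP => g x xg.
exact: (fd _ _ (grhomP u xg)).
Qed.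

Fact grdual_map_subproof (f : grdual N) : hdual_map u f \in @grdual_pred G R M.
Proof.
case: f => _ /= /grdualP[s [y [yc ->]]]; apply/grdualP.
exists s, (fun d => hdual_map u (y d)); split; last by rewrite raddf_sum.
by move=> d; apply: hdual_map_comp.
Qed.

Definition grdual_map (f : grdual N) : grdual M := GrDual (grdual_map_subproof f).

Fact grdual_map_linear : linear grdual_map.
Proof. by move=> a f g; apply: grdual_ext. Qed.

HB.instance Definition _ :=
  GRing.isLinear.Build R^c (grdual N) (grdual M) _ grdual_map grdual_map_linear.

Fact grdual_map_homog d : {in mcomp d, forall f, grdual_map f \in mcomp d}.
Proof. by move=> f; apply: hdual_map_comp. Qed.

Definition grdual_hom : grhom (grdual N) (grdual M) := GrHom grdual_map_homog.

End GradedDualMap.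

Section GradedCan.
Variables (G : groupType) (R : grStarRingType G) (M : grmodType R).

Fact grcan0_subproof (x : M) : hermitian (fun f : grdual M => star (f x)).
Proof.
split=> [f g | a f]; first by rewrite grdual_valD hdual_addE starD.
by rewrite grdual_valZ hdual_actE starM.
Qed.

Definition grcan0 (x : M) : hdual (grdual M) := Hdual (grcan0_subproof x).

Fact grcan0_linear : linear grcan0.
Proof.
move=> a x y; apply: hdual_ext => f /=.
by rewrite hdualD hdualZ starD starM starK.
Qed.

HB.instance Definition _ :=
  GRing.isLinear.Build R^c M (hdual (grdual M)) _ grcan0 grcan0_linear.

Lemma grcan0_comp d : {in mcomp d, forall x, grcan0 x \in @dual_comp G R (grdual M) d}.
Proof.
move=> x xd; apply/dual_compP => g f /dual_compP fg /=.
by rewrite -[d]invgK -invgM; apply/rcomp_star/fg.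
Qed.

Fact grcan_subproof (x : M) : grcan0 x \in @grdual_pred G R (grdual M).
Proof.
have [s [y [yc ->]]] := grading_span (@mcomp_grading G R M) x.
apply/grdualP; exists s, (fun d => grcan0 (y d)); split; last by rewrite raddf_sum.
by move=> d; apply: grcan0_comp.
Qed.

Definition grcan (x : M) : grdual (grdual M) := GrDual (grcan_subproof x).

Fact grcan_linear : linear grcan.
Proof. by move=> a x y; apply/val_inj/(grcan0_linear a x y). Qed.

HB.instance Definition _ :=
  GRing.isLinear.Build R^c M (grdual (grdual M)) _ grcan grcan_linear.

Fact grcan_homog d : {in mcomp d, forall x, grcan x \in mcomp d}.
Proof. exact: grcan0_comp. Qed.

Definition grcan_hom : grhom M (grdual (grdual M)) := GrHom grcan_homog.

End GradedCan.

Section GradedDuality.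
Variables (G : groupType) (R : grStarRingType G).

Definition grdualfunctor : functor (opcat (grcat R)) (grcat R).
Proof.
refine (@Functor (opcat (grcat R)) (grcat R) (fun M : grmodType R => grdual M)
  (fun (M N : grmodType R) (u : grhom N M) => grdual_hom u) _ _);
by move=> *; apply: grhom_ext => f; apply: grdual_ext.
Defined.

Definition grdualcat : dualcat.
Proof.
refine (@DualCat (grcat R) grdualfunctor (@grcan_hom G R) _ _).
- by move=> M N u; apply: grhom_ext => x; apply: grdual_ext.
- move=> M; apply: grhom_ext => f; apply: grdual_ext => x.
  exact: starK.
Defined.

End GradedDuality.

Section DegreeOneMap.
Variables (G : groupType) (R : grStarRingType G) (M N : grmodType R).
Variable u : grhom M N.

Definition deg1map (x : deg1mod M) : deg1mod N := Deg1Mod (grhomP u (valP x)).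

Fact deg1map_linear : linear deg1map.
Proof.
move=> a x y; apply: deg1mod_ext.
rewrite -[LHS]/(u (mdeg1val (x <* (a : deg1ring R) + y))).
by rewrite mdeg1valD mdeg1valZ linearD linearZ.
Qed.

HB.instance Definition _ := GRing.isLinear.Build (deg1ring R)^c
  (deg1mod M) (deg1mod N) _ deg1map deg1map_linear.

End DegreeOneMap.

Section DegreeOneForm.
Variables (G : groupType) (R : grStarRingType G) (M : grmodType R).

Fact deg1phi_in (f : deg1mod (grdual M)) (x : deg1mod M) :
  (mdeg1val f : grdual M) (mdeg1val x) \in @deg1_pred G R.
Proof.
have /dual_compP /(_ _ _ (valP x)) := valP f.
by rewrite invg1 mulg1.
Qed.

Fact deg1phi_hermitian (f : deg1mod (grdual M)) :
  hermitian (fun x : deg1mod M => Deg1Ring (deg1phi_in f x)).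
Proof.
split=> [x y | a x]; apply: deg1ring_ext.
  rewrite -[LHS]/(grdual_val (mdeg1val f) (mdeg1val (x + y))).
  by rewrite mdeg1valD hdualD.
rewrite -[LHS]/(grdual_val (mdeg1val f) (mdeg1val (x <* a))).
by rewrite mdeg1valZ hdualZ.
Qed.

Definition deg1phi (f : deg1mod (grdual M)) : hdual (deg1mod M) :=
  Hdual (deg1phi_hermitian f).

Lemma deg1phiE (f : deg1mod (grdual M)) (x : deg1mod M) :
  deg1val (deg1phi f x) = (mdeg1val f : grdual M) (mdeg1val x).
Proof. by []. Qed.

Fact deg1phi_linear : linear deg1phi.
Proof.
move=> a f g; apply: hdual_ext => x; apply: deg1ring_ext.
rewrite hdual_addE hdual_actE [RHS]deg1valD deg1valM !deg1phiE.
by rewrite mdeg1valD mdeg1valZ grdual_valD grdual_valZ hdual_addE hdual_actE.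
Qed.

HB.instance Definition _ := GRing.isLinear.Build (deg1ring R)^c
  (deg1mod (grdual M)) (hdual (deg1mod M)) _ deg1phi deg1phi_linear.

End DegreeOneForm.

Section DegreeOneFunctor.
Variables (G : groupType) (R : grStarRingType G).

Definition deg1functor : functor (grcat R) (modcat (deg1ring R)).
Proof.
refine (@Functor (grcat R) (modcat (deg1ring R))
  (fun M : grmodType R => deg1mod M)
  (fun (M N : grmodType R) (u : grhom M N) => deg1map u) _ _);
by move=> *; apply: linear_ext => x; apply: deg1mod_ext.
Defined.

Definition deg1form : formfunctor (grdualcat R) (moddualcat (deg1ring R)).
Proof.
refine (@FormFunctor (grdualcat R) (moddualcat (deg1ring R)) deg1functor
  (fun M : grmodType R => @deg1phi G R M) _ _).
- by move=> M N u; apply: linear_ext => f; apply: hdual_ext => x; apply: deg1ring_ext.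
- by move=> M; apply: linear_ext => x; apply: hdual_ext => f; apply: deg1ring_ext.
Defined.

End DegreeOneFunctor.

Section Tensor.
Variables (G : groupType) (R : grStarRingType G) (N : lmodType (deg1ring R)^c).

(* Formal sums of symbols n (x) r, modulo the least congruence making (x)   *)
(* biadditive and R_1-balanced. Opposites need not be added freely, since   *)
(* (- n) (x) r is then an opposite of n (x) r.                              *)
Inductive tens_cong : seq (N * R) -> seq (N * R) -> Prop :=
| tens_refl s : tens_cong s s
| tens_sym s t : tens_cong s t -> tens_cong t s
| tens_trans s t w : tens_cong s t -> tens_cong t w -> tens_cong s w
| tens_cat s s' t t' : tens_cong s s' -> tens_cong t t' ->
    tens_cong (s ++ t) (s' ++ t')
| tens_catC s t : tens_cong (s ++ t) (t ++ s)
| tens_congDl n n' r : tens_cong [:: (n + n', r)] [:: (n, r); (n', r)]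
| tens_congDr n r r' : tens_cong [:: (n, r + r')] [:: (n, r); (n, r')]
| tens_cong0 r : tens_cong [:: (0, r)] [::]
| tens_cong_bal n (a : deg1ring R) r :
    tens_cong [:: (n <* a, r)] [:: (n, (a : R) * r)].

Definition tens_rel : rel (seq (N * R)) := fun s t => `[< tens_cong s t >].

Fact tens_rel_equiv : equiv_class_of tens_rel.
Proof.
split; first by move=> s; apply/asboolP/tens_refl.
  by move=> s t; apply/asboolP/asboolP; apply: tens_sym.
by move=> s t w /asboolP st /asboolP tw; apply/asboolP/(tens_trans st tw).
Qed.

Canonical tens_equiv := EquivRelPack tens_rel_equiv.

Definition tens := {eq_quot tens_equiv}.

HB.instance Definition _ := Choice.on tens.
HB.instance Definition _ := EqQuotient.on tens.

Implicit Types (x y z : tens) (s t : seq (N * R)).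

Definition tens_class s : tens := \pi s.

Lemma tens_classP s t : tens_class s = tens_class t <-> tens_cong s t.
Proof.
split=> [/eqquotP /asboolP // | st]; apply/eqquotP; exact/asboolP.
Qed.

Lemma tens_reprK x : tens_class (repr x) = x.
Proof. exact: reprK. Qed.

Lemma tens_repr s : tens_cong (repr (tens_class s)) s.
Proof. by apply/tens_classP; rewrite tens_reprK. Qed.

Lemma tens_classW (P : tens -> Prop) : (forall s, P (tens_class s)) -> forall x, P x.
Proof. by move=> Ps x; rewrite -[x]tens_reprK. Qed.

Definition tens_opps s := [seq (- p.1, p.2) | p <- s].

Definition tens_add x y : tens := tens_class (repr x ++ repr y).
Definition tens_zero : tens := tens_class [::].
Definition tens_opp x : tens := tens_class (tens_opps (repr x)).

Lemma tens_addE s t : tens_add (tens_class s) (tens_class t) = tens_class (s ++ t).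
Proof. by apply/tens_classP/tens_cat; apply: tens_repr. Qed.

Fact tens_addA : associative tens_add.
Proof.
elim/tens_classW=> s; elim/tens_classW=> t; elim/tens_classW=> w.
by rewrite !tens_addE catA.
Qed.

Fact tens_addC : commutative tens_add.
Proof.
elim/tens_classW=> s; elim/tens_classW=> t; rewrite !tens_addE.
by apply/tens_classP/tens_catC.
Qed.

Fact tens_add0 : left_id tens_zero tens_add.
Proof. by elim/tens_classW=> s; rewrite tens_addE. Qed.

Lemma tens_cancel s : tens_cong (tens_opps s ++ s) [::].
Proof.
elim: s => [|[n r] s IH] /=; first exact: tens_refl.
have nE : tens_cong [:: (- n, r); (n, r)] [::].
  by apply: tens_trans (tens_sym (tens_congDl _ _ _)) _; rewrite addNr; apply: tens_cong0.
apply: tens_trans (tens_cat nE IH); rewrite -cat1s -[(n, r) :: s]cat1s.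
rewrite -[[:: (- n, r); (n, r)]]cat1s -catA.
apply: tens_cat; first exact: tens_refl.
rewrite catA [X in tens_cong _ X]catA.
by apply: tens_cat; [exact: tens_catC | exact: tens_refl].
Qed.

Fact tens_addN : left_inverse tens_zero tens_opp tens_add.
Proof.
move=> x; rewrite -{2}[x]tens_reprK tens_addE.
by apply/tens_classP/tens_cancel.
Qed.

HB.instance Definition _ := GRing.isZmodule.Build tens
  tens_addA tens_addC tens_add0 tens_addN.

Definition tprod (n : N) (r : R) : tens := tens_class [:: (n, r)].

Lemma tens_class_sum s : tens_class s = \sum_(p <- s) tprod p.1 p.2.
Proof.
elim: s => [|[n r] s IH]; first by rewrite big_nil.
by rewrite big_cons -IH; apply/esym/tens_addE.
Qed.

Lemma tens_span x : exists s : seq (N * R), x = \sum_(p <- s) tprod p.1 p.2.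
Proof. by exists (repr x); rewrite -tens_class_sum tens_reprK. Qed.

Lemma tprodDl n n' r : tprod (n + n') r = tprod n r + tprod n' r.
Proof. by rewrite [RHS]tens_addE; apply/tens_classP/tens_congDl. Qed.
Lemma tprodDr n r r' : tprod n (r + r') = tprod n r + tprod n r'.
Proof. by rewrite [RHS]tens_addE; apply/tens_classP/tens_congDr. Qed.
Lemma tprod_bal n (a : deg1ring R) r : tprod (n <* a) r = tprod n ((a : R) * r).
Proof. exact/tens_classP/tens_cong_bal. Qed.
Lemma tprod0r n : tprod n 0 = 0.
Proof. by apply: (@addrI _ (tprod n 0)); rewrite -tprodDr !addr0. Qed.
Lemma tprod_sumr n I r (P : pred I) (F : I -> R) :
  tprod n (\sum_(i <- r | P i) F i) = \sum_(i <- r | P i) tprod n (F i).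
Proof. by apply: (big_morph _ (tprodDr n) (tprod0r n)). Qed.

Record balanced (A : zmodType) (f : N -> R -> A) : Prop := Balanced {
  balDl : forall n n' r, f (n + n') r = f n r + f n' r;
  balDr : forall n r r', f n (r + r') = f n r + f n r';
  bal_act : forall n (a : deg1ring R) r, f (n <* a) r = f n ((a : R) * r) }.

Definition tens_lift (A : zmodType) (f : N -> R -> A) (x : tens) : A :=
  \sum_(p <- repr x) f p.1 p.2.

Section Lift.
Variables (A : zmodType) (f : N -> R -> A).
Hypothesis fb : balanced f.

Lemma tens_lift_cong s t : tens_cong s t ->
  \sum_(p <- s) f p.1 p.2 = \sum_(p <- t) f p.1 p.2.
Proof.
elim=> {s t} //=.
- by move=> s t w _ -> _ ->.
- by move=> s s' t t' _ ss _ tt; rewrite !big_cat ss tt.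
- by move=> s t; rewrite !big_cat /= addrC.
- by move=> n n' r; rewrite !big_cons !big_nil !addr0 (balDl fb).
- by move=> n r r'; rewrite !big_cons !big_nil !addr0 (balDr fb).
- move=> r; rewrite big_seq1 big_nil /=.
  by apply: (@addrI _ (f 0 r)); rewrite -(balDl fb) !addr0.
- by move=> n a r; rewrite !big_seq1 (bal_act fb).
Qed.

Lemma tens_lift_class s : tens_lift f (tens_class s) = \sum_(p <- s) f p.1 p.2.
Proof. exact/tens_lift_cong/tens_repr. Qed.

Lemma tens_liftE n r : tens_lift f (tprod n r) = f n r.
Proof. by rewrite tens_lift_class big_seq1. Qed.

Lemma tens_liftD : {morph tens_lift f : x y / x + y}.
Proof.
elim/tens_classW=> s; elim/tens_classW=> t.
by rewrite [_ + _ in LHS]tens_addE !tens_lift_class big_cat.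
Qed.

End Lift.

Lemma tens_eq (A : zmodType) (u v : tens -> A) :
  {morph u : x y / x + y} -> {morph v : x y / x + y} ->
  (forall n r, u (tprod n r) = v (tprod n r)) -> u =1 v.
Proof.
move=> uD vD uv x; have [s ->] := tens_span x.
have u0 : u 0 = 0 by apply: (@addrI _ (u 0)); rewrite -uD !addr0.
have v0 : v 0 = 0 by apply: (@addrI _ (v 0)); rewrite -vD !addr0.
by rewrite (big_morph _ uD u0) (big_morph _ vD v0); apply: eq_bigr.
Qed.

Fact tens_act_balanced (a : R^c) : balanced (fun n r => tprod n (r * (a : R))).
Proof.
by split=> [n n' r|n r r'|n b r]; rewrite ?tprodDl ?mulrDl ?tprodDr // tprod_bal mulrA.
Qed.

Definition tens_act (a : R^c) (x : tens) : tens :=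
  tens_lift (fun n r => tprod n (r * (a : R))) x.

Lemma tens_actE (a : R) n r : tens_act a (tprod n r) = tprod n (r * a).
Proof. exact: tens_liftE (tens_act_balanced a) _ _. Qed.

Fact tens_actDr : right_distributive tens_act +%R.
Proof. by move=> a; apply: tens_liftD (tens_act_balanced a). Qed.

Fact tens_actA a b v : tens_act a (tens_act b v) = tens_act (a * b) v.
Proof.
move: v; apply: tens_eq => [x y|x y|n r]; rewrite ?tens_actDr //.
by rewrite !tens_actE mulrA.
Qed.

Fact tens_act1 : left_id 1 tens_act.
Proof.
apply: tens_eq => [x y|//|n r]; first exact: tens_actDr.
by rewrite (tens_actE 1) mulr1.
Qed.

Fact tens_actDl v : {morph tens_act^~ v : a b / a + b}.
Proof.
move=> a b; move: v; apply: tens_eq => [x y|x y|n r]; rewrite ?tens_actDr //.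
  by rewrite addrACA.
by rewrite (tens_actE (a + b)) mulrDr tprodDr !tens_actE.
Qed.

HB.instance Definition _ := GRing.Zmodule_isLmodule.Build R^c tens
  tens_actA tens_act1 tens_actDr tens_actDl.

Lemma tprod_act n r (a : R) : tprod n r <* a = tprod n (r * a).
Proof. exact: tens_actE. Qed.

(* N (x) R_g, identified with its image in N (x) R.                         *)
Definition tens_comp (g : G) : {pred tens} := [pred x : tens |
  `[< exists s : seq (N * R),
        (forall p, p \in s -> p.2 \in rcomp g) /\
        x = \sum_(p <- s) tprod p.1 p.2 >]].

Lemma tens_compP g x : reflect (exists s : seq (N * R),
    (forall p, p \in s -> p.2 \in rcomp g) /\ x = \sum_(p <- s) tprod p.1 p.2)
  (x \in tens_comp g).
Proof. exact: asboolP. Qed.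

Let grR := @rcomp_grading G R.

Lemma tprod_comp g n r : r \in rcomp g -> tprod n r \in tens_comp g.
Proof.
move=> rg; apply/tens_compP; exists [:: (n, r)]; split; last by rewrite big_seq1.
by move=> p; rewrite inE => /eqP->.
Qed.

Fact tens_comp_closed g : zmod_closed (tens_comp g).
Proof.
split=> [|x y /tens_compP[s [sg ->]] /tens_compP[t [tg ->]]].
  by apply/tens_compP; exists [::]; split=> //; rewrite big_nil.
apply/tens_compP; exists (s ++ tens_opps t); split.
  move=> p; rewrite mem_cat => /orP[/sg//|/mapP[q /tg qg ->]] //.
rewrite big_cat big_map -sumrN; congr (_ + _); apply: eq_bigr => p _ /=.
apply/eqP; rewrite eq_sym -subr_eq0 opprK -tprodDl addNr; apply/eqP.
by apply: (@addrI _ (tprod 0 p.2)); rewrite -tprodDl !addr0.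
Qed.

Fact tens_proj_balanced g : balanced (fun n r => tprod n (hproj grR r g)).
Proof.
have pD r r' : hproj grR (r + r') g = hproj grR r g + hproj grR r' g.
  rewrite -[r' in LHS]opprK hprojB -[- r']sub0r hprojB.
  by rewrite (hproj_id grR (grading0 grR g)) sub0r opprK.
split=> [n n' r|n r r'|n a r]; rewrite ?tprodDl ?pD ?tprodDr //.
rewrite tprod_bal; congr tprod.
have [s us [rc r0 rE]] := hprojP grR r.
rewrite (@hproj_uniq _ _ _ grR s (fun h => (a : R) * hproj grR r h)
  ((a : R) * r)) //.
- by move=> h; rewrite -[h in rcomp h]mul1g; apply: rcompM (valP a) (rc h).
- by move=> h /r0->; rewrite mulr0.
- by rewrite {1}rE mulr_sumr.
Qed.

Fact tens_grading : grading tens_comp.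
Proof.
pose p g := tens_lift (fun n r => tprod n (hproj grR r g)).
have pD g := tens_liftD (tens_proj_balanced g).
have p0 g : p g 0 = 0 by apply: (@addrI _ (p g 0)); rewrite -pD !addr0.
apply: (@grading_of_proj G _ _ p) => //.
- exact: tens_comp_closed.
- elim/tens_classW=> s; rewrite tens_class_sum.
  elim: s => [|[n r] s [t [y [yc yE]]]].
    exists [::], (fun=> 0); rewrite !big_nil; split=> // g.
    by case: (tens_comp_closed g).
  have [w uw [rc r0 rE]] := hprojP grR r.
  exists (undup (w ++ t)), (fun g => y g *+ count_mem g t + tprod n (hproj grR r g)).
  split=> [g|].
    have [c0 cB] := tens_comp_closed g.
    have cD u v : u \in tens_comp g -> v \in tens_comp g -> u + v \in tens_comp g.
      by move=> ug vg; rewrite -[v]opprK -[- v]sub0r; apply: (cB) => //; apply: cB.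
    apply: (cD); last exact: tprod_comp.
    by elim: (count_mem g t) => [//|k IH]; rewrite mulrS; apply: cD.
  rewrite big_cons yE big_split /= [LHS]addrC; congr (_ + _).
    apply: (@big_count_subset G); first exact: undup_uniq.
    by move=> g; rewrite mem_undup mem_cat orbC => ->.
  rewrite {1}rE tprod_sumr; apply: (@big_support_subset G) => //;
      try exact: undup_uniq.
    by move=> g; rewrite mem_undup mem_cat => ->.
  by move=> g /r0 ->; rewrite tprod0r.
- move=> g x /tens_compP[s [sg ->]]; rewrite (big_morph (p g) (pD g) (p0 g)).
  apply: eq_big_seq => q /sg qg; rewrite /p (tens_liftE (tens_proj_balanced g)).
  by rewrite hproj_id.
- move=> g h hg x /tens_compP[s [sg ->]]; rewrite (big_morph (p g) (pD g) (p0 g)).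
  apply: big1_seq => q /andP[_ /sg qg]; rewrite /p (tens_liftE (tens_proj_balanced g)).
  by rewrite (hproj_neq _ qg) ?tprod0r // eq_sym.
Qed.

Fact tens_comp_act g h (x : tens) (a : R) :
  x \in tens_comp g -> a \in rcomp h -> x <* a \in tens_comp (g * h)%g.
Proof.
move=> /tens_compP[s [sg ->]] ah; apply/tens_compP.
exists [seq (p.1, p.2 * a) | p <- s]; split.
  by move=> p /mapP[q qs ->] /=; apply: rcompM => //; apply: sg.
rewrite scaler_sumr big_map; apply: eq_bigr => q _; exact: tprod_act.
Qed.

HB.instance Definition _ :=
  Lmodule_isGraded.Build G R tens tens_grading tens_comp_act.

Lemma hdual_tens_ext (f g : hdual tens) :
  (forall n r, f (tprod n r) = g (tprod n r)) -> f = g.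
Proof.
by move=> fg; apply: hdual_ext; apply: tens_eq => // x y; apply: hdualD.
Qed.

End Tensor.

Section TensorMap.
Variables (G : groupType) (R : grStarRingType G).
Variables (M N : lmodType (deg1ring R)^c) (u : {linear M -> N}).

Fact tens_map_balanced : balanced (fun m r => tprod (u m) r).
Proof.
by split=> [n n' r|n r r'|n a r]; rewrite ?linearD ?tprodDl ?tprodDr // linearZ tprod_bal.
Qed.

Definition tens_map : tens M -> tens N := tens_lift (fun m r => tprod (u m) r).

Lemma tens_mapE m r : tens_map (tprod m r) = tprod (u m) r.
Proof. exact: tens_liftE tens_map_balanced _ _. Qed.

Lemma tens_mapD : {morph tens_map : x y / x + y}.
Proof. exact: tens_liftD tens_map_balanced. Qed.

Fact tens_map_linear : linear tens_map.
Proof.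
move=> a x y; rewrite tens_mapD; congr (_ + _).
move: x; apply: tens_eq => [x y'|x y'|n r].
- by rewrite ractDl tens_mapD.
- by rewrite tens_mapD ractDl.
- by rewrite tprod_act !tens_mapE tprod_act.
Qed.

HB.instance Definition _ :=
  GRing.isLinear.Build R^c (tens M) (tens N) _ tens_map tens_map_linear.

Fact tens_map_homog g : {in mcomp g, forall x, tens_map x \in mcomp g}.
Proof.
move=> x /tens_compP[s [sg ->]]; apply/tens_compP.
exists [seq (u p.1, p.2) | p <- s]; split; first by move=> p /mapP[q /sg qg ->].
by rewrite raddf_sum big_map; apply: eq_bigr => q _; apply: tens_mapE.
Qed.

Definition tens_hom : grhom (tens M) (tens N) := GrHom tens_map_homog.

End TensorMap.

Section TensorForm.
Variables (G : groupType) (R : grStarRingType G) (N : lmodType (deg1ring R)^c).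

Fact psi0_balanced (f : hdual N) (r : R) :
  balanced (fun n s => star s * (f n : R) * r).
Proof.
split=> [n n' s|n s s'|n a s].
- by rewrite hdualD /= mulrDr mulrDl.
- by rewrite starD !mulrDl.
- by rewrite hdualZ /= starM !mulrA.
Qed.

Fact psi0_hermitian (f : hdual N) (r : R) :
  hermitian (tens_lift (fun n s => star s * (f n : R) * r) : tens N -> R).
Proof.
have fb := psi0_balanced f r; split; first exact: tens_liftD.
move=> a; apply: tens_eq => [x y|x y|n s].
- by rewrite ractDl (tens_liftD fb).
- by rewrite (tens_liftD fb) mulrDr.
- by rewrite tprod_act !(tens_liftE fb) starM !mulrA.
Qed.

Definition psi0 (f : hdual N) (r : R) : hdual (tens N) := Hdual (psi0_hermitian f r).

Lemma psi0E f r n s : psi0 f r (tprod n s) = star s * (f n : R) * r.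
Proof. exact: tens_liftE (psi0_balanced f r) _ _. Qed.

Lemma psi0_comp d f r : r \in rcomp d -> psi0 f r \in @dual_comp G R (tens N) d.
Proof.
have grR := @rcomp_grading G R.
move=> rd; apply/dual_compP => g x /tens_compP[s [sg ->]].
rewrite hdual_sum big_seq; apply: (grading_sum grR) => p ps; rewrite psi0E.
apply: rcompM => //; rewrite -(mulg1 (g^-1)%g).
by apply: rcompM; [exact: rcomp_star (sg p ps) | exact: valP].
Qed.

Fact psi0_balanced2 : balanced psi0.
Proof.
split=> [f f' r|f r r'|f a r]; apply: hdual_tens_ext => n s.
- by rewrite hdual_addE !psi0E hdual_addE deg1valD mulrDr mulrDl.
- by rewrite hdual_addE !psi0E mulrDr.
- by rewrite !psi0E hdual_actE deg1valM !mulrA.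
Qed.

Definition psi1 (x : tens (hdual N)) : hdual (tens N) := tens_lift psi0 x.

Lemma psi1E f r : psi1 (tprod f r) = psi0 f r.
Proof. exact: tens_liftE psi0_balanced2 _ _. Qed.

Lemma psi1D : {morph psi1 : x y / x + y}.
Proof. exact: tens_liftD psi0_balanced2. Qed.

Lemma psi1_0 : psi1 0 = 0.
Proof. by apply: (@addrI _ (psi1 0)); rewrite -psi1D !addr0. Qed.

Lemma psi1_comp d : {in mcomp d, forall x, psi1 x \in @dual_comp G R (tens N) d}.
Proof.
move=> x /tens_compP[s [sg ->]]; rewrite (big_morph _ psi1D psi1_0) big_seq.
have [c0 cB] := @dual_comp_closed G R (tens N) d.
apply: (big_ind [in @dual_comp G R (tens N) d]) => // [f f'|p ps]; first exact: dual_compD.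
by rewrite psi1E; apply/psi0_comp/sg.
Qed.

Fact psi_subproof (x : tens (hdual N)) : psi1 x \in @grdual_pred G R (tens N).
Proof.
have [s [y [yc ->]]] := grading_span (@mcomp_grading G R (tens (hdual N))) x.
apply/grdualP; exists s, (fun d => psi1 (y d)); split.
  by move=> d; apply: psi1_comp.
by rewrite (big_morph _ psi1D psi1_0).
Qed.

Definition psi (x : tens (hdual N)) : grdual (tens N) := GrDual (psi_subproof x).

Lemma psiE f r n s : psi (tprod f r) (tprod n s) = star s * (f n : R) * r.
Proof. by rewrite /= psi1E psi0E. Qed.

Lemma psi1Z (a : R) x : psi1 (x <* a) = psi1 x <* a.
Proof.
move: x; apply: tens_eq => [x z|x z|f r].
- by rewrite ractDl psi1D.
- by rewrite psi1D ractDl.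
rewrite tprod_act !psi1E; apply: hdual_tens_ext => n s.
by rewrite hdual_actE !psi0E mulrA.
Qed.

Fact psi_linear : linear psi.
Proof. by move=> a x y; apply: val_inj; rewrite [LHS]psi1D psi1Z. Qed.

HB.instance Definition _ := GRing.isLinear.Build R^c
  (tens (hdual N)) (grdual (tens N)) _ psi psi_linear.

Fact psi_homog d : {in mcomp d, forall x, psi x \in mcomp d}.
Proof. exact: psi1_comp. Qed.

Definition psi_hom : grhom (tens (hdual N)) (grdual (tens N)) := GrHom psi_homog.

End TensorForm.

Section TensorFunctor.
Variables (G : groupType) (R : grStarRingType G).

Definition tensfunctor : functor (modcat (deg1ring R)) (grcat R).
Proof.
refine (@Functor (modcat (deg1ring R)) (grcat R)
  (fun N : lmodType (deg1ring R)^c => tens N)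
  (fun (M N : lmodType (deg1ring R)^c) (u : {linear M -> N}) => tens_hom u) _ _).
- move=> N; apply: grhom_ext; apply: tens_eq => // [x y|n r]; first exact: tens_mapD.
  exact: tens_mapE.
- move=> M N P v u; apply: grhom_ext; apply: tens_eq => [x y|x y|n r].
  + exact: tens_mapD.
  + by rewrite /= !tens_mapD.
  + by rewrite /= !tens_mapE.
Defined.

Definition tensform : formfunctor (moddualcat (deg1ring R)) (grdualcat R).
Proof.
refine (@FormFunctor (moddualcat (deg1ring R)) (grdualcat R) tensfunctor
  (fun N : lmodType (deg1ring R)^c => @psi_hom G R N) _ _).
- move=> M N u; apply: grhom_ext; apply: tens_eq => [x y|x y|f r].
  + by rewrite /= !linearD.
  + by rewrite /= !linearD.
  apply: grdual_ext; apply: tens_eq => [x y|x y|m s]; try exact: hdualD.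
  rewrite -[LHS]/(psi (tens_map (hdual_map u) (tprod f r)) (tprod m s)).
  rewrite -[RHS]/(psi (tprod f r) (tens_map u (tprod m s))).
  by rewrite !tens_mapE !psiE.
- move=> N; apply: grhom_ext; apply: tens_eq => [x y|x y|n s].
  + by rewrite /= !linearD.
  + by rewrite /= !linearD.
  apply: grdual_ext; apply: tens_eq => [x y|x y|f r]; try exact: hdualD.
  rewrite -[LHS]/(star (psi (tprod f r) (tprod n s))).
  rewrite -[RHS]/(psi (tens_map (@hdual_can _ N) (tprod n s)) (tprod f r)).
  by rewrite tens_mapE !psiE !starM starK mulrA.
Defined.

End TensorFunctor.

Definition strongly_graded (G : groupType) (R : grStarRingType G) : Prop :=
  forall (g h : G) (x : R),
    (exists2 s : seq (R * R),
       (forall p, p \in s -> p.1 \in rcomp g /\ p.2 \in rcomp h)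
     & x = \sum_(p <- s) p.1 * p.2)
    <-> x \in rcomp (g * h)%g.

(* Main.v *)
Require Import Defs.
From HB Require Import structures.
From mathcomp Require Import all_boot all_order all_algebra.
From mathcomp Require Import boolp.

(** Write R_1 for the degree one subring and M_1 for the degree one part of M.

    Two maps compare the composite functors with the identities. For a graded
    module M there is the multiplication M_1 (x) R -> M, m (x) r |-> m r; for
    an R_1-module N there is N -> (N (x) R)_1, n |-> n (x) 1. Both are natural
    and, by direct evaluation on tensors, compatible with phi and psi.

    The second map is bijective over every R: an element of degree one is a
    sum of tensors n (x) r with r in R_1, hence equals (sum of n r) (x) 1, and
    r |-> r_1 induces a retraction. The first one is bijective when R is
    strongly graded: the equality R_(g^-1) R_g = R_1 provides a decomposition
    1 = sum_j a_j b_j with a_j in R_(g^-1) and b_j in R_g. For m of degree g,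
    m = sum_j (m a_j) b_j is a product of elements of M_1 and of R; and if
    x = sum_i m_i (x) r_i has degree g and sum_i m_i r_i = 0, then
      x = sum_ij m_i (x) r_i a_j b_j = sum_j (sum_i m_i r_i) a_j (x) b_j = 0.
    These are [mulmap_surj_homog] and [mulmap_ker_homog].

    Conversely, N (x) R is generated over R by its degree one part, and this
    property passes to every graded module onto which N (x) R maps by a
    surjection with a graded section. So if M_1 (x) R is isomorphic to M for
    every graded M, by whatever isomorphism, then all graded modules are
    generated in degree one. For the shifted module R(g), with
    R(g)_h = R_(gh), this says exactly that R_(gh) = R_g R_h; this is
    [grhom_onto_shift]. *)

Set Implicit Arguments.
Unset Strict Implicit.
Unset Printing Implicit Defensive.

Import GRing.Theory.
Local Open Scope ring_scope.

(** * Generalities on graded modules and tensor products *)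

Section GradedIso.
Variables (G : groupType) (R : grStarRingType G).

(** The set-theoretic inverse of a bijective graded map is linear, and it
    preserves degrees because preimages of homogeneous elements can be chosen
    homogeneous. Surjectivity follows from the case of homogeneous elements,
    since these span N. *)
Lemma grhom_is_iso (M N : grmodType R) (u : grhom M N) :
  injective u ->
  (forall g y, y \in mcomp g -> exists2 x, x \in mcomp g & u x = y) ->
  @is_iso (grcat R) M N u.
Proof.
move=> uI uS.
have /choice[v vK] y : exists x, u x = y.
  have [s [z [zc ->]]] := grading_span (@mcomp_grading G R N) y.
  apply: (big_ind (fun y => exists x, u x = y)) => [|_ _ [x <-] [x' <-]|g _].
  - by exists 0; rewrite linear0.
  - by exists (x + x'); rewrite linearD.
  - by have [x _ <-] := uS g _ (zc g); exists x.
have uK : cancel u v by move=> x; apply: uI; rewrite vK.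
have vlin : linear v by apply: (can2_linear uK vK).
pose vL : {linear N -> M} := HB.pack v (GRing.isLinear.Build R^c N M _ v vlin).
have vP g : {in mcomp g, forall y, vL y \in mcomp g}.
  by move=> y /uS[x xg <-]; rewrite [vL _]uK.
by exists (GrHom vP); apply: grhom_ext => x /=; [apply: uK | apply: vK].
Qed.

End GradedIso.

Lemma mdeg1val_sum (G : groupType) (R : grStarRingType G) (M : grmodType R)
    I (s : seq I) (F : I -> deg1mod M) :
  mdeg1val (\sum_(i <- s) F i) = \sum_(i <- s) mdeg1val (F i).
Proof. exact: (raddf_sum (val : deg1mod M -> M)). Qed.

Lemma tprod0l (G : groupType) (R : grStarRingType G)
    (N : lmodType (deg1ring R)^c) (r : R) : tprod (0 : N) r = 0.
Proof. by apply: (@addrI _ (tprod 0 r)); rewrite -tprodDl !addr0. Qed.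

(** * The multiplication map from M_1 (x) R to M *)

Section Multiplication.
Variables (G : groupType) (R : grStarRingType G) (M : grmodType R).

Fact mulmap_balanced :
  balanced (fun (m : deg1mod M) (r : R) => mdeg1val m <* r).
Proof.
split=> [m m' r|m r r'|m a r].
- by rewrite mdeg1valD ractDl.
- exact: ractDr.
- by rewrite mdeg1valZ ractA.
Qed.

Definition mulmap : tens (deg1mod M) -> M :=
  tens_lift (fun (m : deg1mod M) (r : R) => mdeg1val m <* r).

Lemma mulmapE m r : mulmap (tprod m r) = mdeg1val m <* r.
Proof. exact: tens_liftE mulmap_balanced _ _. Qed.

Fact mulmap_linear : linear mulmap.
Proof.
have mD : {morph mulmap : x y / x + y} := tens_liftD mulmap_balanced.
move=> a x y; rewrite mD; congr (_ + _).
move: x; apply: tens_eq => [x z|x z|m r].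
- by rewrite ractDl mD.
- by rewrite mD ractDl.
- by rewrite tprod_act !mulmapE ractA.
Qed.

HB.instance Definition _ := GRing.isLinear.Build R^c
  (tens (deg1mod M)) M _ mulmap mulmap_linear.

Lemma mulmap_sum (s : seq (deg1mod M * R)) :
  mulmap (\sum_(p <- s) tprod p.1 p.2) = \sum_(p <- s) mdeg1val p.1 <* p.2.
Proof.
by rewrite (linear_sum mulmap); apply: eq_bigr => p _; apply: mulmapE.
Qed.

Fact mulmap_homog g : {in mcomp g, forall x, mulmap x \in mcomp g}.
Proof.
move=> x /tens_compP[s [sg ->]]; rewrite mulmap_sum big_seq.
apply: (grading_sum (@mcomp_grading G R M)) => p /sg pg.
by rewrite -[g in mcomp g]mul1g; apply: mcomp_act (valP p.1) pg.
Qed.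

Definition mulhom : grhom (tens (deg1mod M)) M := GrHom mulmap_homog.

Section Strong.
Hypothesis strongR : strongly_graded R.

Lemma strongly_graded_one g : exists2 s : seq (R * R),
    forall p, p \in s -> p.1 \in rcomp g^-1%g /\ p.2 \in rcomp g
  & 1 = \sum_(p <- s) p.1 * p.2.
Proof. by apply/strongR; rewrite mulVg; apply: rcomp1. Qed.

(** Inserting 1 = sum_j a_j b_j on the right of every r_i turns
    x = sum_i m_i (x) r_i into sum_j (sum_i m_i r_i a_j) (x) b_j, because the
    degree one factors r_i a_j move across the tensor sign. *)
Lemma mulmap_ker_homog g x : x \in mcomp g -> mulmap x = 0 -> x = 0.
Proof.
move=> /tens_compP[s [sg xE]] x0.
have [t tg t1] := strongly_graded_one g.
transitivity (\sum_(q <- t) \sum_(p <- s) tprod p.1 (p.2 * (q.1 * q.2))).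
  rewrite exchange_big xE; apply: eq_bigr => p _.
  by rewrite -tprod_sumr -mulr_sumr -t1 mulr1.
apply: big1_seq => q /= /tg[q1 q2].
have rin p : p \in s -> p.2 * q.1 \in deg1_pred (R := R).
  by move=> /sg pg; rewrite /deg1_pred -(mulgV g); apply: rcompM.
(* For x = sum_i m_i (x) r_i and q = (a, b), this sum is the element
   (sum_i m_i r_i) a of M_1. As the r_i a lie in R_1, [insubd] only changes
   their type. *)
have n0 : \sum_(p <- s) p.1 <* insubd (0 : deg1ring R) (p.2 * q.1) = 0.
  apply: deg1mod_ext; rewrite mdeg1val_sum.
  transitivity (mulmap x <* q.1); last by rewrite x0 scaler0.
  rewrite xE mulmap_sum scaler_sumr; apply: eq_big_seq => p ps.
  by rewrite mdeg1valZ ractA [deg1val _]insubdK //; apply: rin.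
transitivity (tprod (\sum_(p <- s) p.1 <* insubd (0 : deg1ring R) (p.2 * q.1)) q.2).
  rewrite (big_morph (fun n => tprod n q.2) (fun n n' => tprodDl n n' q.2)
    (tprod0l _ _)).
  apply: eq_big_seq => p ps.
  by rewrite tprod_bal mulrA [deg1val _]insubdK //; apply: rin.
by rewrite n0 tprod0l.
Qed.

(** The kernel of a degree-preserving map is spanned by its homogeneous
    elements. *)
Lemma mulmap_inj : injective mulmap.
Proof.
move=> x y /eqP; rewrite -subr_eq0 -raddfB => /eqP.
move: (x - y) (subr0_eq (x := x) (y := y)) => z /[swap] mz0; apply.
have [s us [zc z0 zE]] := hprojP (@mcomp_grading G R (tens (deg1mod M))) z.
rewrite zE big1_seq // => g /= gs; apply: (mulmap_ker_homog (zc g)).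
pose w h := mulmap (hproj (@mcomp_grading G R (tens (deg1mod M))) z h).
apply: (grading_indep (@mcomp_grading G R M) us (y := w) _ _ gs) => [h|].
  exact: mulmap_homog.
by rewrite -(linear_sum mulmap) -zE.
Qed.

(** The preimage is sum_j (m a_j) (x) b_j, where the m a_j lie in M_1. *)
Lemma mulmap_surj_homog g m :
  m \in mcomp g -> exists2 x, x \in mcomp g & mulmap x = m.
Proof.
move=> mg; have [t tg t1] := strongly_graded_one g.
have nin q : q \in t -> m <* q.1 \in mdeg1_pred (M := M).
  by move=> /tg[q1 _]; rewrite /mdeg1_pred -(mulgV g); apply: mcomp_act.
exists (\sum_(q <- t) tprod (insubd (0 : deg1mod M) (m <* q.1)) q.2).
  rewrite big_seq; apply: (grading_sum (@mcomp_grading G R _)) => q /tg[_ q2].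
  exact: tprod_comp.
rewrite -[RHS]ract1 t1 raddf_sum (scaler_suml (R := R^c)).
apply: eq_big_seq => q /nin qt.
by rewrite /= mulmapE [mdeg1val _]insubdK // ractA.
Qed.

End Strong.
End Multiplication.

(** * The isomorphism between N and (N (x) R)_1 *)

Section Unit.
Variables (G : groupType) (R : grStarRingType G) (N : lmodType (deg1ring R)^c).

Let grR := @rcomp_grading G R.

Definition tens_unit (n : N) : deg1mod (tens N) :=
  Deg1Mod (tprod_comp n (@rcomp1 G R)).

Fact tens_unit_linear : linear tens_unit.
Proof.
move=> a x y; apply: deg1mod_ext; rewrite mdeg1valD mdeg1valZ /=.
by rewrite tprodDl tprod_bal tprod_act mulr1 mul1r.
Qed.

HB.instance Definition _ := GRing.isLinear.Build (deg1ring R)^c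
  N (deg1mod (tens N)) _ tens_unit tens_unit_linear.

(** In n (x) r with r in R_1 the factor r can be moved to the left. Besides
    surjectivity, this reduces every identity on (N (x) R)_1 to pure tensors
    n (x) 1. *)
Lemma tens_unit_surj (x : deg1mod (tens N)) : exists n, x = tens_unit n.
Proof.
case: x => x x1; have /tens_compP[s [sg xE]] := x1.
exists (\sum_(p <- s) p.1 <* insubd (0 : deg1ring R) p.2).
rewrite raddf_sum; apply: deg1mod_ext.
rewrite mdeg1val_sum /= xE.
apply: eq_big_seq => p /sg pg.
by rewrite tprod_bal mulr1 [deg1val _]insubdK.
Qed.

Definition rproj1 (r : R) : deg1ring R := Deg1Ring (hproj_in grR r 1%g).

Lemma rproj1D : {morph rproj1 : r r' / r + r'}.
Proof.
move=> r r'; apply: deg1ring_ext => /=; rewrite -[r' in LHS]opprK hprojB.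
by rewrite -[- r']sub0r hprojB (hproj_id grR (grading0 grR 1%g)) sub0r opprK.
Qed.

Lemma rproj1M (a : deg1ring R) r : rproj1 ((a : R) * r) = a * rproj1 r.
Proof.
apply: deg1ring_ext => /=; have [s us [rc r0 rE]] := hprojP grR r.
rewrite (@hproj_uniq _ _ _ grR s (fun h => (a : R) * hproj grR r h)) //.
- by move=> h; rewrite -[h in rcomp h]mul1g; apply: rcompM (valP a) (rc h).
- by move=> h /r0->; rewrite mulr0.
- by rewrite {1}rE mulr_sumr.
Qed.

(** Projecting R onto R_1 makes n (x) r |-> n r_1 well defined on all of
    N (x) R, which avoids describing (N (x) R)_1 by generators and
    relations. *)
Fact tens_counit_balanced : balanced (fun (n : N) r => n <* rproj1 r).
Proof.
split=> [n n' r|n r r'|n a r]; first exact: ractDl.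
  by rewrite rproj1D ractDr.
by rewrite rproj1M ractA.
Qed.

Definition tens_counit (x : deg1mod (tens N)) : N :=
  tens_lift (fun (n : N) r => n <* rproj1 r) (mdeg1val x).

Lemma tens_unitK : cancel tens_unit tens_counit.
Proof.
move=> n; rewrite /tens_counit (tens_liftE tens_counit_balanced).
have -> : rproj1 1 = 1 by apply/deg1ring_ext/hproj_id/rcomp1.
exact: ract1.
Qed.

Lemma tens_counitK : cancel tens_counit tens_unit.
Proof. by move=> x; have [n ->] := tens_unit_surj x; rewrite tens_unitK. Qed.

HB.instance Definition _ := GRing.isLinear.Build (deg1ring R)^c
  (deg1mod (tens N)) N _ tens_counit (can2_linear tens_unitK tens_counitK).

End Unit.

(** * Shifted regular modules *)

Section Shift.
Variables (G : groupType) (R : grStarRingType G).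

(** The regular right module R. The index g is kept in the type so that each
    shift carries its own grading. *)
Definition shift of G : Type := (R^c)^o.

Variable g : G.

HB.instance Definition _ := GRing.Lmodule.on (shift g).

Definition shift_comp (h : G) : {pred shift g} := rcomp (s := R) (g * h)%g.

Fact shift_grading : grading shift_comp.
Proof.
have grR := @rcomp_grading G R; split.
- by move=> h; apply: grading_closed grR _.
- move=> x; have [s [y [yc xE]]] := grading_span grR (x : R).
  exists [seq (g^-1 * h)%g | h <- s], (fun h => y (g * h)%g); split=> //.
  by rewrite big_map; under eq_bigr do rewrite mulVKg.
- move=> s y us yc y0 h hs.
  have /(_ [seq (g * k)%g | k <- s] (fun k => y (g^-1 * k)%g)) :=
    grading_indep grR.
  rewrite (map_inj_uniq (@mulgI _ g)) => /(_ us) /(_ _ _ (g * h)%g).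
  rewrite mulKg; apply; last exact: map_f.
    by move=> k; rewrite -{2}[k](mulVKg g); apply: yc.
  by rewrite big_map; under eq_bigr do rewrite mulKg.
Qed.

Fact shift_act h k (x : shift g) (a : R) :
  x \in shift_comp h -> a \in rcomp k -> x <* a \in shift_comp (h * k)%g.
Proof. by move=> xh ak; rewrite unfold_in mulgA; apply: rcompM. Qed.

HB.instance Definition _ :=
  Lmodule_isGraded.Build G R (shift g) shift_grading shift_act.

End Shift.

(** Writing v x as a sum of tensors n (x) r with r in R_h gives
    x = u (v x) = sum u (n (x) 1) r, and u maps the degree one elements
    n (x) 1 into R(g)_1 = R_g. *)
Lemma grhom_onto_shift (G : groupType) (R : grStarRingType G)
    (N : lmodType (deg1ring R)^c) g h (u : grhom (tens N) (shift R g))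
    (v : grhom (shift R g) (tens N)) (x : R) :
  cancel v u -> x \in rcomp (g * h)%g ->
  exists2 s : seq (R * R),
    forall p, p \in s -> p.1 \in rcomp g /\ p.2 \in rcomp h
  & x = \sum_(p <- s) p.1 * p.2.
Proof.
move=> vK xgh; have xh : (x : shift R g) \in mcomp h by [].
have /tens_compP[s [sh vxE]] := grhomP v xh.
exists [seq (u (tprod p.1 1) : R, p.2) | p <- s].
  move=> _ /mapP[p ps ->]; split; last exact: sh.
  rewrite -[X in rcomp X]mulg1; apply: (grhomP u).
  exact: tprod_comp (@rcomp1 G R).
rewrite big_map -[LHS](vK (x : shift R g)) vxE (linear_sum u).
apply: eq_bigr => p _.
by rewrite -[p.2 in LHS]mul1r -tprod_act linearZ.
Qed.

Theorem theorem4p3 (G : groupType) (R : grStarRingType G) :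
  strongly_graded R <-> mutual_inverse_equivalences (deg1form R) (tensform R).
Proof.
split=> [strongR | [[theta [_ theta_iso _]] _] g h x].
  split.
    exists (fun M : grmodType R => mulhom M); split.
    - move=> M N u; apply: grhom_ext; apply: tens_eq => [x y|x y|m r];
        try exact: linearD.
      by rewrite /= tens_mapE !mulmapE /= linearZ.
    - move=> M; apply: grhom_is_iso; first exact: mulmap_inj.
      exact: mulmap_surj_homog.
    - move=> M; apply: grhom_ext; apply: tens_eq => [x y|x y|f r];
        try exact: linearD.
      apply: grdual_ext; apply: tens_eq => [x y|x y|m s]; try exact: hdualD.
      (* Both sides evaluate to s^* f(m) r. *)
      rewrite -[LHS]/(psi (tens_map (@deg1phi G R M) (tprod f r)) (tprod m s)).
      rewrite -[RHS]/((mulmap (tprod f r) : grdual M) (mulmap (tprod m s))).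
      by rewrite tens_mapE psiE !mulmapE hdualZ -mulrA.
  exists (fun N : lmodType (deg1ring R)^c =>
    (@tens_counit G R N : {linear deg1mod (tens N) -> N})); split.
  - move=> M N u; apply: linear_ext => x; have [n ->] := tens_unit_surj x.
    rewrite -[LHS]/(tens_counit (deg1map (tens_hom u) (tens_unit n))).
    rewrite -[RHS]/(u (tens_counit (tens_unit n))).
    have -> : deg1map (tens_hom u) (tens_unit n) = tens_unit (u n).
      exact/deg1mod_ext/tens_mapE.
    by rewrite !tens_unitK.
  - move=> N; exists (@tens_unit G R N : {linear N -> deg1mod (tens N)}); apply: linear_ext => x.
      exact: tens_counitK.
    exact: tens_unitK.
  - move=> N; apply: linear_ext => x; have [f ->] := tens_unit_surj x.
    apply: hdual_ext => y; have [n ->] := tens_unit_surj y.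
    (* On f (x) 1 and n (x) 1 both sides evaluate to f n. *)
    rewrite -[RHS]/(tens_counit (tens_unit f) (tens_counit (tens_unit n))).
    rewrite !tens_unitK; apply: deg1ring_ext.
    rewrite -[LHS]/(psi (tprod f 1) (tprod n 1)).
    by rewrite psiE star1 mul1r mulr1.
split=> [[s sP ->]|xgh].
  rewrite big_seq; apply: (grading_sum (@rcomp_grading G R)) => p /sP[p1 p2].
  exact: rcompM.
have [v _ vK] := theta_iso (shift R g).
apply: (@grhom_onto_shift G R _ g h (theta (shift R g)) v) => // y.
exact: (congr1 (fun w : grhom (shift R g) (shift R g) => w y) vK).
Qed.
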